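(* Let $f(\cdot,\xi)$ be $(H_0,H_1)$-smooth and convex for almost every $\xi\sim\mathcal D$, and let the stochastic gradient oracle be unbiased and satisfy the strong growth condition with constant $\rho\ge1$, i.e. $\mathbb{E}_\xi[\|\nabla f(x,\xi)\|^2]\le\rho\|\nabla f(x)\|^2$ for all $x\in\mathbb{R}^d$. Then ClipSGD with clipping radius $c>0$, constant step size $$0<\eta\le\left[9\left(H_0+\max\{\sqrt{H_1},H_1R_0\}\,c\right)\right]^{-1}$$ and batch size $B\ge36(\rho-1)$ guarantees, after $N$ iterations, $$\mathbb{E}[f(x^N)]-f^*\le\max\left\{\left(1-\frac{\eta c}{36R_0}\right)^{N/2}F_0,\ \frac{18R_0^2}{N\eta}\right\},$$ where $R_0=\|x^0-x^*\|$ and $F_0=f(x^0)-f^*$.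
   Context: Setting: $f(x)=\mathbb{E}_{\xi\sim\mathcal D}[f(x,\xi)]$ on $\mathbb{R}^d$, with $f$ and $f(\cdot,\xi)$ differentiable, $f^*=\min_{x}f(x)$, $x^*\in\arg\min f$, and $\|\cdot\|$ the Euclidean norm. The oracle returns stochastic gradients $\nabla f(x,\xi)$, $\xi\sim\mathcal D$. ''$f(\cdot,\xi)$ is $(H_0,H_1)$-smooth'' means: for all $x,y\in\mathbb{R}^d$ with $\|y-x\|\le1/\sqrt{H_1}$, $$\|\nabla f(y,\xi)-\nabla f(x,\xi)\|\le\big(H_0+H_1[f(x,\xi)-f_\xi^*]\big)\|y-x\|,\qquad f_\xi^*:=\inf_{x\in\mathbb{R}^d}f(x,\xi).$$ Convexity of $f(\cdot,\xi)$: $f(y,\xi)\ge f(x,\xi)+\langle\nabla f(x,\xi),y-x\rangle$ for all $x,y$. Unbiasedness: $\mathbb{E}_\xi[\nabla f(x,\xi)]=\nabla f(x)$ for all $x$. ClipSGD: given $x^0\in\mathbb{R}^d$, integer batch size $B\ge1$, $\eta>0$, $c>0$; at iteration $k$ draw fresh i.i.d. samples $\xi_1^k,\dots,\xi_B^k\sim\mathcal D$ (independent of the past), form $g^k=\frac1B\sum_{i=1}^B\nabla f(x^k,\xi_i^k)$, and set $x^{k+1}=x^k-\eta\,\min\{1,c/\|g^k\|\}\,g^k$ (the factor is $1$ if $g^k=0$). *)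

(* Defs.v *)
From HB Require Import structures.
From mathcomp Require Import all_boot all_order all_algebra.
From mathcomp Require Import all_classical all_reals all_analysis.
Set Implicit Arguments.
Unset Strict Implicit.
Unset Printing Implicit Defensive.
Import Order.TTheory GRing.Theory Num.Theory.
Import numFieldNormedType.Exports.
Local Open Scope classical_set_scope.
Local Open Scope ring_scope.

Definition dotp (R : realType) (d : nat) (u v : 'rV[R]_d) : R :=
  \sum_(i < d) u ord0 i * v ord0 i.

(* The Euclidean norm; the library norm [`|u|] on matrices is the sup norm. *)
Definition enorm (R : realType) (d : nat) (u : 'rV[R]_d) : R :=
  Num.sqrt (dotp u u).

Definition grad (R : realType) (d : nat) (g : 'rV[R]_d -> R) (x : 'rV[R]_d) :
    'rV[R]_d :=
  \row_(i < d) 'D_(delta_mx ord0 i) g x.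

Definition grad_convex (R : realType) (d : nat) (g : 'rV[R]_d -> R) : Prop :=
  forall x y : 'rV[R]_d, g x + dotp (grad g x) (y - x) <= g y.

(* The restriction ||y - x|| <= 1 / sqrt H1 is written without division, so that
   it is void when H1 = 0 (in the library 0^-1 = 0). The infimum is taken in the
   extended reals, hence is -oo when g is unbounded below. *)
Definition H0H1_smooth (R : realType) (d : nat) (H0 H1 : R)
    (g : 'rV[R]_d -> R) : Prop :=
  forall x y : 'rV[R]_d, Num.sqrt H1 * enorm (y - x) <= 1 ->
    ((enorm (grad g y - grad g x))%:E <=
      (H0%:E + H1%:E * ((g x)%:E - ereal_inf (range (fun z => (g z)%:E))))
      * (enorm (y - x))%:E)%E.

Definition objective (R : realType) (d : nat) (dT : measure_display)
    (T : measurableType dT) (D : probability T R) (f : 'rV[R]_d -> T -> R)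
    (x : 'rV[R]_d) : R :=
  fine ('E_D[f x])%E.

Definition unbiased_oracle (R : realType) (d : nat) (dT : measure_display)
    (T : measurableType dT) (D : probability T R) (f : 'rV[R]_d -> T -> R) :
    Prop :=
  forall (x : 'rV[R]_d) (i : 'I_d),
    ('E_D[fun xi => grad (f^~ xi) x ord0 i]
     = (grad (objective D f) x ord0 i)%:E)%E.

Definition strong_growth (R : realType) (d : nat) (dT : measure_display)
    (T : measurableType dT) (D : probability T R) (f : 'rV[R]_d -> T -> R)
    (rho : R) : Prop :=
  forall x : 'rV[R]_d,
    ('E_D[fun xi => (enorm (grad (f^~ xi) x) ^+ 2)%R]
      <= (rho * enorm (grad (objective D f) x) ^+ 2)%:E)%E.

Definition mutually_independent (R : realType) (dO dT : measure_display)
    (Omega : measurableType dO) (T : measurableType dT)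
    (P : probability Omega R) (I : choiceType) (X : I -> {RV P >-> T}) : Prop :=
  forall (J : seq I) (A : I -> set T), uniq J ->
    (forall i, measurable (A i)) ->
    P (\bigcap_(i in [set` J]) (X i @^-1` A i))
    = (\prod_(i <- J) P (X i @^-1` A i))%E.

Definition iid (R : realType) (dO dT : measure_display)
    (Omega : measurableType dO) (T : measurableType dT)
    (P : probability Omega R) (D : probability T R)
    (I : choiceType) (X : I -> {RV P >-> T}) : Prop :=
  (forall (i : I) (A : set T), measurable A -> distribution P (X i) A = D A)
  /\ mutually_independent X.

Definition clip_factor (R : realType) (d : nat) (c : R) (g : 'rV[R]_d) : R :=
  if g == 0 then 1 else Num.min 1 (c / enorm g).

Definition batch_grad (R : realType) (d : nat) (T : Type)
    (f : 'rV[R]_d -> T -> R) (B : nat) (s : 'I_B -> T) (x : 'rV[R]_d) :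
    'rV[R]_d :=
  B%:R^-1 *: \sum_(i < B) grad (f^~ (s i)) x.

(* [s k i] is the i-th sample of the batch drawn at iteration k. *)
Fixpoint clip_sgd (R : realType) (d : nat) (T : Type)
    (f : 'rV[R]_d -> T -> R) (B : nat) (eta c : R) (x0 : 'rV[R]_d)
    (s : nat -> 'I_B -> T) (k : nat) : 'rV[R]_d :=
  if k is k'.+1 then
    let x := clip_sgd f eta c x0 s k' in
    let g := batch_grad f (s k') x in
    x - (eta * clip_factor c g) *: g
  else x0.

(* Main.v *)
Require Import Defs.
From HB Require Import structures.
From mathcomp Require Import all_boot all_order all_algebra.
From mathcomp Require Import all_classical all_reals all_analysis.
From mathcomp Require Import measurable_realfun ring lra.
Set Implicit Arguments.
Unset Strict Implicit.
Unset Printing Implicit Defensive.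
Import Order.TTheory GRing.Theory Num.Theory.
Import numFieldNormedType.Exports.
Local Open Scope classical_set_scope.
Local Open Scope ring_scope.

(** The engine of the proof is interpolation. Since the gradient of f vanishes
    at x*, strong growth makes the gradient of almost every sample vanish there
    as well, so by convexity x* minimises almost every f(., xi) and the infimum
    in the smoothness condition is f(x*, xi) ([ae_good_sample]). Each sample then
    satisfies a descent inequality with curvature H0 + H1 (f(x, xi) - f(x*, xi)),
    which is affine in the function and therefore passes both to the batch average
    ([batch_gap_descent]) and to the expectation f ([objective_descent]).

    Write eta_k for eta times the clipping factor. The bound on eta makes eta_k
    times the curvature of the batch at most 1/9. Two facts follow. First, a step
    is a short gradient step for a convex function minimised at x*, so it never
    moves away from x* ([clipped_step_contracts]); almost surely all iterates
    stay in the ball of radius R0 and convexity gives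
    f(x^k) - f* <= R0 ||grad f(x^k)||. Second, with w = min(1, c / ||grad f(x)||)
    and delta = ||g - grad f(x)||, one step decreases f by at least
      eta w (4/9 ||grad f(x)||^2 - 29/9 delta^2)
    ([clipped_step_decreases]); clipping makes the step biased, and
    [clip_weight_dotp] bounds the bias in terms of delta.

    Strong growth and the batch size give E[w delta^2] <= E[w ||grad f||^2] / 36
    ([weighted_deviation_mean]): the samples of a batch are revealed one at a
    time, each being independent of the sigma-algebra of the samples drawn before
    it ([past_independent], [integral_past]), so their variances add up. Hence
    E f(x^{k+1}) + eta/3 E[w ||grad f||^2] <= E f(x^k) ([expected_decrease]).

    With h = (f(x^k) - f* ) / R0 the gain w ||grad f||^2 is at least h min(c, h).
    This is not convex in h, but it lies above its tangents at the points
    t <= c/2 ([huber_tangent]), and taking expectations of the tangents yields a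
    scalar recursion for u_k = E f(x^k) - f*: a step either contracts u by a
    fixed factor, or increases 1/u by a fixed amount. Among N steps at least N/2
    are of one of the two kinds, whence the maximum ([two_phase_rate]). *)

(** * Euclidean geometry of row vectors *)

Section Euclidean.
Context {R : realType} {d : nat}.
Implicit Types (u v w : 'rV[R]_d) (a : R).

Lemma dotpC u v : dotp u v = dotp v u.
Proof. by apply: eq_bigr => i _; rewrite mulrC. Qed.

Lemma dotpDl u v w : dotp (u + v) w = dotp u w + dotp v w.
Proof. by rewrite -big_split; apply: eq_bigr => i _; rewrite mxE mulrDl. Qed.

Lemma dotpZl a u v : dotp (a *: u) v = a * dotp u v.
Proof. by rewrite mulr_sumr; apply: eq_bigr => i _; rewrite mxE mulrA. Qed.

Lemma dotpNl u v : dotp (- u) v = - dotp u v.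
Proof. by rewrite -scaleN1r dotpZl mulN1r. Qed.

Lemma dotpDr u v w : dotp w (u + v) = dotp w u + dotp w v.
Proof. by rewrite dotpC dotpDl !(dotpC w). Qed.

Lemma dotpZr a u v : dotp v (a *: u) = a * dotp v u.
Proof. by rewrite dotpC dotpZl (dotpC v). Qed.

Lemma dotpNr u v : dotp u (- v) = - dotp u v.
Proof. by rewrite dotpC dotpNl dotpC. Qed.

Definition dotpE := (dotpDl, dotpDr, dotpNl, dotpNr, dotpZl, dotpZr).

Lemma dotp0l v : dotp 0 v = 0.
Proof. by rewrite -(scale0r 0) dotpZl mul0r. Qed.

Lemma dotp_suml (I : finType) (F : I -> 'rV[R]_d) v :
  dotp (\sum_i F i) v = \sum_i dotp (F i) v.
Proof.
exact: (big_morph (fun u => dotp u v) (fun u w => dotpDl u w v) (dotp0l v)).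
Qed.

Lemma dotp_ge0 u : 0 <= dotp u u.
Proof. by apply: sumr_ge0 => i _; rewrite -expr2 sqr_ge0. Qed.

Lemma enorm_ge0 u : 0 <= enorm u.
Proof. exact: sqrtr_ge0. Qed.

Lemma enorm_sqr u : enorm u ^+ 2 = dotp u u.
Proof. by rewrite sqr_sqrtr // dotp_ge0. Qed.

Lemma enorm0_eq0 u : enorm u = 0 -> u = 0.
Proof.
move=> u0; have /eqP := enorm_sqr u; rewrite u0 expr0n /= eq_sym.
rewrite psumr_eq0 => [/allP uz|i _]; last by rewrite -expr2 sqr_ge0.
apply/rowP => i; rewrite mxE; apply/eqP.
by have := uz i; rewrite mem_index_enum mulf_eq0 orbb; apply.
Qed.

Lemma enorm0 : enorm (0 : 'rV[R]_d) = 0.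
Proof. by rewrite /enorm dotp0l sqrtr0. Qed.

Lemma enormZ a u : enorm (a *: u) = `|a| * enorm u.
Proof. by rewrite /enorm !dotpE mulrA -expr2 sqrtrM ?sqr_ge0// sqrtr_sqr. Qed.

Lemma enormN u : enorm (- u) = enorm u.
Proof. by rewrite -scaleN1r enormZ normrN1 mul1r. Qed.

Lemma cauchy_schwarz u v : dotp u v <= enorm u * enorm v.
Proof.
have [v0|v0] := eqVneq (enorm v) 0.
  by rewrite (enorm0_eq0 v0) dotpC dotp0l enorm0 mulr0.
have vp : 0 < enorm v by rewrite lt_def v0 enorm_ge0.
have := dotp_ge0 (enorm v ^+ 2 *: u - dotp u v *: v).
rewrite !dotpE -!enorm_sqr (dotpC v u).
move: (dotp u v) (enorm u) (enorm_ge0 u) => p a a0.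
move=> h; have {h}: 0 <= enorm v ^+ 2 * ((a * enorm v) ^+ 2 - p ^+ 2) by lra.
rewrite pmulr_rge0 ?exprn_gt0// subr_ge0 => /(ler_wsqrtr).
by rewrite !sqrtr_sqr (ger0_norm (mulr_ge0 a0 (ltW vp))); apply/le_trans/ler_norm.
Qed.

Lemma enorm_coord u i : `|u ord0 i| <= enorm u.
Proof.
rewrite -sqrtr_sqr ler_wsqrtr // /dotp (bigD1 i) //= -expr2 lerDl.
by apply: sumr_ge0 => j _; rewrite -expr2 sqr_ge0.
Qed.

Lemma ler_enormB u v : enorm u <= enorm v + enorm (u - v).
Proof.
rewrite -ler_sqr ?nnegrE ?addr_ge0 ?enorm_ge0// sqrrD !enorm_sqr !dotpE.
have := cauchy_schwarz v (u - v); rewrite !dotpE (dotpC v u) -mulr_natl; lra.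
Qed.

End Euclidean.

(** This equals min(1, c / r) for c > 0 and r >= 0, with value 1 at r = 0, so
    that the clipping factor needs no case distinction at a zero gradient. *)
Definition clip_weight (R : realType) (c r : R) : R := c / Num.max c r.

(** * Clipping *)

Section ClipFactor.
Context {R : realType} {d : nat}.
Implicit Types (g : 'rV[R]_d) (c : R).

Lemma clip_factorE c g : 0 < c ->
  clip_factor c g *: g = clip_weight c (enorm g) *: g.
Proof.
rewrite /clip_factor /clip_weight => c0; have [->|g0] := eqVneq g 0; first by rewrite !scaler0.
have gp : 0 < enorm g.
  by rewrite lt_def enorm_ge0 andbT; apply: contra_neq g0 => /enorm0_eq0.
congr (_ *: _); have [gc|gc] := leP (enorm g) c.
  by rewrite (min_idPl _) ?divff ?gt_eqF// ler_pdivlMr ?mul1r.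
by rewrite (min_idPr _)// ler_pdivrMr ?mul1r// ltW.
Qed.

End ClipFactor.

(** * Convex smooth functions *)

Section OneSample.
Context {R : realType} {d : nat} (H0 H1 : R) (g : 'rV[R]_d -> R) (xs : 'rV[R]_d).
Hypotheses (g_convex : grad_convex g).

Lemma convex_gap x : g x - g xs <= dotp (grad g x) (x - xs).
Proof. by have := g_convex x xs; rewrite -(opprB x xs) dotpNr; lra. Qed.

Hypotheses (g_smooth : H0H1_smooth H0 H1 g) (g_min : forall z, g xs <= g z).

(** Convexity at y bounds g y - g x by the inner product with the gradient at y;
    replacing it by the gradient at x costs one application of smoothness. The
    constant is twice the one obtained by integrating along the segment, which
    the step size leaves room for. *)
Lemma convex_smooth_descent x y : Num.sqrt H1 * enorm (y - x) <= 1 ->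
  g y <= g x + dotp (grad g x) (y - x)
         + (H0 + H1 * (g x - g xs)) * enorm (y - x) ^+ 2.
Proof.
move=> /g_smooth.
have -> : ereal_inf (range (fun z => (g z)%:E)) = (g xs)%:E.
  apply/eqP; rewrite eq_le; apply/andP; split.
    by apply: ereal_inf_lbound; exists xs.
  by apply: le_ereal_inf_tmp => _ [z _ <-]; rewrite lee_fin.
rewrite (_ : (_ * _)%E = ((H0 + H1 * (g x - g xs)) * enorm (y - x))%:E) // lee_fin.
move=> yx.
have := g_convex y x.
have := cauchy_schwarz (grad g y - grad g x) (y - x).
have : enorm (grad g y - grad g x) * enorm (y - x)
    <= (H0 + H1 * (g x - g xs)) * enorm (y - x) ^+ 2.
  by rewrite expr2 mulrA ler_wpM2r ?enorm_ge0.
rewrite -(opprB y x) dotpNr !dotpDl !dotpNl; lra.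
Qed.

End OneSample.

(** * One clipped step *)

Section ClipWeight.
Context {R : realType}.
Implicit Types (c r : R).

Lemma clip_weight1 c r : 0 < c -> r <= c -> clip_weight c r = 1.
Proof. by move=> c0 rc; rewrite /clip_weight (max_idPl rc) divff ?gt_eqF. Qed.

Lemma clip_weightM c r : 0 < c -> c <= r -> clip_weight c r * r = c.
Proof.
move=> c0 cr; rewrite /clip_weight (max_idPr cr) divfK// gt_eqF//.
exact: lt_le_trans cr.
Qed.

Lemma clip_weight_gt0 c r : 0 < c -> 0 < clip_weight c r.
Proof. by move=> c0; rewrite divr_gt0// lt_max c0. Qed.

Lemma clip_weight_le1 c r : 0 < c -> clip_weight c r <= 1.
Proof.
by move=> c0; rewrite /clip_weight ler_pdivrMr ?lt_max ?c0// mul1r le_max lexx.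
Qed.

Lemma clip_weightM_le c r : 0 < c -> clip_weight c r * r <= c.
Proof.
move=> c0; have [rc|cr] := leP r c; first by rewrite clip_weight1// mul1r.
by rewrite clip_weightM// ltW.
Qed.

(** Here F is an objective gap, r the gradient norm and D a distance to the
    minimiser: the bound F <= r D converts the gain of a clipped step into a
    function of the gap. *)
Lemma clip_weightM_sq c r (F D : R) : 0 < c -> 0 <= r -> 0 <= F -> 0 < D ->
  F <= r * D -> F / D * Num.min c (F / D) <= clip_weight c r * r ^+ 2.
Proof.
move=> c0 r0 F0 D0 FD.
have h : F / D <= r by rewrite ler_pdivrMr.
have h0 : 0 <= F / D by rewrite divr_ge0// ltW.
have m0 : 0 <= Num.min c (F / D) by rewrite le_min h0 ltW.
rewrite expr2 mulrA [X in _ <= X]mulrC; apply: ler_pM => //.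
have [rc|/ltW cr] := leP r c; last by rewrite clip_weightM// ge_min lexx.
by rewrite clip_weight1// mul1r ge_min h orbT.
Qed.

End ClipWeight.

Section ClippedStep.
Context {R : realType} {d : nat}.
Implicit Types (g G x : 'rV[R]_d) (c : R).

(** Clipping projects onto a ball, so a deviation of size delta of g from G costs
    at most 2 delta times the clipped norm w ||G|| in the inner product. The loss
    has to scale with w ||G|| rather than ||G||, because delta is comparable to
    ||G||, which may be much larger than c. *)
Lemma clip_weight_dotp c G g : 0 < c ->
  clip_weight c (enorm G) * enorm G * (enorm G - 2 * enorm (g - G))
  <= clip_weight c (enorm g) * dotp G g.
Proof.
move=> c0.
have p1 := cauchy_schwarz G (G - g).
have p2 := cauchy_schwarz g (g - G).
have p3 := cauchy_schwarz G g.
have p4 := cauchy_schwarz G (- g).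
have n1 := ler_enormB g G.
have n2 := ler_enormB G g.
move: p1 p2 p3 p4 n1 n2; rewrite -(opprB g G) !enormN !dotpE (dotpC g G) -!enorm_sqr.
move: (dotp G g) (enorm g) (enorm G) (enorm (g - G))
  (enorm_ge0 g) (enorm_ge0 G) (enorm_ge0 (g - G)).
move=> p n r e n0 r0 e0 p1 p2 p3 p4 n1 n2.
have [rc|/ltW cr] := leP r c; have [nc|cn] := leP n c.
- rewrite (clip_weight1 c0 rc) (clip_weight1 c0 nc).
  have := mulr_ge0 r0 e0; lra.
- rewrite (clip_weight1 c0 rc) !mul1r.
  have w1 := clip_weight_le1 n c0.
  have : (1 - clip_weight c n) * p <= (1 - clip_weight c n) * (r * n).
    by rewrite ler_wpM2l// subr_ge0.
  have : r * (clip_weight c n * n) = r * c by rewrite clip_weightM// ltW.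
  have : 0 <= r * (c - r) by rewrite mulr_ge0 // subr_ge0.
  have : 0 <= r * (r + e - n) by rewrite mulr_ge0 // subr_ge0.
  lra.
- rewrite (clip_weightM c0 cr) (clip_weight1 c0 nc) mul1r.
  have ce := mulr_ge0 (ltW c0) e0.
  have [er|/ltW re] := leP e r.
    have : 0 <= (r - c) * (r - e) by rewrite mulr_ge0 // subr_ge0.
    lra.
  have : 0 <= c * (e - r) by rewrite mulr_ge0 ?subr_ge0// ltW.
  have : 0 <= r * (c - n) by rewrite mulr_ge0 // subr_ge0.
  lra.
- rewrite (clip_weightM c0 cr) -[X in X * _ <= _](clip_weightM c0 (ltW cn)).
  rewrite -mulrA ler_pM2l ?clip_weight_gt0//.
  have : 0 <= n * (n + e - r) by rewrite mulr_ge0 // subr_ge0.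
  lra.
Qed.

(** The squared length of the clipped step in a form that the curvature bound
    [stepsize_gap] can absorb: one factor w = clip_weight c ||G|| compensates the
    growth of the curvature with ||G||, the other one stays. *)
Lemma clip_weight_sqr c G g : 0 < c ->
  (clip_weight c (enorm g) * enorm g) ^+ 2 <=
  clip_weight c (enorm G) ^+ 2 * (2 * enorm G ^+ 2 + 2 * enorm (g - G) ^+ 2).
Proof.
move=> c0; have := ler_enormB g G.
move: (enorm g) (enorm G) (enorm (g - G))
  (enorm_ge0 g) (enorm_ge0 G) (enorm_ge0 (g - G)) => n r e n0 r0 e0 nre.
have w0 := clip_weight_gt0 n c0.
have w1 := clip_weight_le1 n c0.
have [rc|/ltW cr] := leP r c.
  rewrite (clip_weight1 c0 rc) expr1n mul1r.
  apply: (@le_trans _ _ (n ^+ 2)); last first.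
    have : n ^+ 2 <= (r + e) ^+ 2 by rewrite ler_sqr ?nnegrE ?addr_ge0.
    have := sqr_ge0 (r - e); lra.
  by rewrite ler_sqr ?nnegrE ?(mulr_ge0 (ltW w0))// ler_piMl.
have := clip_weightM_le n c0.
have := clip_weightM c0 cr.
set a := clip_weight c r; set b := clip_weight c n => ac bc.
have : (b * n) ^+ 2 <= (a * r) ^+ 2.
  by rewrite ac ler_sqr ?nnegrE ?(mulr_ge0 (ltW w0))// ltW.
have := mulr_ge0 (sqr_ge0 a) (sqr_ge0 e); have := sqr_ge0 (a * r); lra.
Qed.

Variables (H0 H1 eta c R0 : R).
Hypotheses (H0_ge0 : 0 <= H0) (H1_ge0 : 0 <= H1) (c_gt0 : 0 < c)
  (eta_gt0 : 0 < eta) (R0_ge0 : 0 <= R0).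
Hypothesis eta_small :
  eta * (9 * (H0 + Num.max (Num.sqrt H1) (H1 * R0) * c)) <= 1.

Lemma stepsize_radius : eta * (Num.sqrt H1 * c) <= 1.
Proof.
have : Num.sqrt H1 * c <= Num.max (Num.sqrt H1) (H1 * R0) * c.
  by rewrite ler_wpM2r ?(ltW c_gt0)// le_max lexx.
rewrite -(ler_pM2l eta_gt0) => h.
have := mulr_ge0 (ltW eta_gt0) H0_ge0.
have := mulr_ge0 (ltW eta_gt0) (mulr_ge0 (sqrtr_ge0 H1) (ltW c_gt0)).
have := eta_small; lra.
Qed.

Lemma stepsize_smoothness : eta * (H0 + H1 * R0 * c) <= 1 / 9.
Proof.
have : H1 * R0 * c <= Num.max (Num.sqrt H1) (H1 * R0) * c.
  by rewrite ler_wpM2r ?(ltW c_gt0)// le_max lexx orbT.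
rewrite -(ler_pM2l eta_gt0) => h.
have := eta_small; lra.
Qed.

(** The curvature H0 + H1 F may grow linearly with the gradient norm r, because
    F <= r R0; the clipping weight shrinks like c / r, so their product stays
    bounded. *)
Lemma stepsize_gap (F r : R) : 0 <= r -> 0 <= F -> F <= r * R0 ->
  clip_weight c r * eta * (H0 + H1 * F) <= 1 / 9.
Proof.
move=> r0 F0 FR; apply: le_trans stepsize_smoothness.
rewrite (mulrC _ eta) -[X in X <= _]mulrA ler_pM2l// mulrDr lerD//.
  by rewrite ler_piMl// clip_weight_le1.
rewrite mulrCA -[X in _ <= X]mulrA ler_wpM2l// (@le_trans _ _ (clip_weight c r * (r * R0)))//.
  by rewrite ler_wpM2l// ltW// clip_weight_gt0.
by rewrite mulrA mulrC ler_wpM2l// clip_weightM_le.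
Qed.

Lemma clipped_step_short g :
  Num.sqrt H1 * enorm ((eta * clip_weight c (enorm g)) *: g) <= 1.
Proof.
have w0 := clip_weight_gt0 (enorm g) c_gt0.
rewrite enormZ (ger0_norm (ltW (mulr_gt0 eta_gt0 w0))) -mulrA.
apply: le_trans stepsize_radius; rewrite mulrCA ler_pM2l//.
by rewrite ler_wpM2l ?sqrtr_ge0// clip_weightM_le.
Qed.

(** The last hypothesis says that F does not fall below its minimum after the
    step. Since the curvature term is at most 1/9 of the linear term, it gives
    t ||g||^2 <= 9/8 F for the step length t, which the first-order gain 2 t F in
    the squared distance outweighs. *)
Lemma clipped_step_contracts x xs g (F : R) :
  enorm (x - xs) <= R0 -> 0 <= F -> F <= dotp g (x - xs) ->
  0 <= F - dotp g ((eta * clip_weight c (enorm g)) *: g)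
       + (H0 + H1 * F) * enorm ((eta * clip_weight c (enorm g)) *: g) ^+ 2 ->
  enorm (x - (eta * clip_weight c (enorm g)) *: g - xs) <= enorm (x - xs).
Proof.
move=> xR F0 Fg.
have w0 := clip_weight_gt0 (enorm g) c_gt0.
have FR : F <= enorm g * R0.
  apply: le_trans Fg _; apply: le_trans (cauchy_schwarz _ _) _.
  by rewrite ler_wpM2l// enorm_ge0.
have := stepsize_gap (enorm_ge0 g) F0 FR.
set t := eta * clip_weight c (enorm g).
have t0 : 0 < t by rewrite mulr_gt0.
rewrite (mulrC (clip_weight _ _)) -/t => tL.
rewrite enormZ (ger0_norm (ltW t0)) dotpZr -enorm_sqr => decr.
rewrite -ler_sqr ?nnegrE ?enorm_ge0// addrAC.
rewrite !enorm_sqr.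
rewrite !dotpE in Fg *; rewrite (dotpC x g) (dotpC xs g).
have : t * enorm g ^+ 2 <= 2 * F.
  have := ler_wpM2r (mulr_ge0 (ltW t0) (sqr_ge0 (enorm g))) tL.
  have := mulr_ge0 (ltW t0) (sqr_ge0 (enorm g)); lra.
move=> /(ler_wpM2l (ltW t0)); have := ler_wpM2l (ltW t0) Fg; rewrite enorm_sqr; lra.
Qed.

(** Combine [clip_weight_dotp] for the linear term with [clip_weight_sqr] and
    [stepsize_gap] for the quadratic term, and split the cross term
    2 ||G|| delta <= ||G||^2 / 3 + 3 delta^2. *)
Lemma clipped_step_decreases x xs g G (F F' : R) :
  enorm (x - xs) <= R0 -> 0 <= F -> F <= dotp G (x - xs) ->
  F' <= F - dotp G ((eta * clip_weight c (enorm g)) *: g)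
        + (H0 + H1 * F) * enorm ((eta * clip_weight c (enorm g)) *: g) ^+ 2 ->
  F' + eta * clip_weight c (enorm G) * (4 / 9) * enorm G ^+ 2 <=
  F + eta * clip_weight c (enorm G) * (29 / 9) * enorm (g - G) ^+ 2.
Proof.
move=> xR F0 FG.
have w0 := clip_weight_gt0 (enorm G) c_gt0.
have FR : F <= enorm G * R0.
  apply: le_trans FG _; apply: le_trans (cauchy_schwarz _ _) _.
  by rewrite ler_wpM2l// enorm_ge0.
have := stepsize_gap (enorm_ge0 G) F0 FR.
have := clip_weight_dotp G g c_gt0.
have := clip_weight_sqr G g c_gt0.
rewrite dotpZr enormZ ger0_norm; last by rewrite ltW// mulr_gt0// clip_weight_gt0.
set w := clip_weight c (enorm G) in w0 *.
set v := clip_weight c (enorm g).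
have L0 : 0 <= H0 + H1 * F by rewrite addr_ge0// mulr_ge0.
move: (enorm G) (enorm (g - G)) (enorm g) (dotp G g) (H0 + H1 * F) L0.
move=> r e n p L L0 vn vp wL F'F.
have h1 : eta * (w * r * (r - 2 * e)) <= eta * (v * p) by rewrite ler_pM2l.
have h2 : L * (eta * v * n) ^+ 2 <= eta * w * (2 * r ^+ 2 + 2 * e ^+ 2) / 9.
  have -> : L * (eta * v * n) ^+ 2 = L * eta ^+ 2 * (v * n) ^+ 2 by ring.
  have s0 : 0 <= 2 * r ^+ 2 + 2 * e ^+ 2 by rewrite addr_ge0// mulr_ge0// sqr_ge0.
  apply: (@le_trans _ _ (L * eta ^+ 2 * (w ^+ 2 * (2 * r ^+ 2 + 2 * e ^+ 2)))).
    by rewrite ler_wpM2l// mulr_ge0// sqr_ge0.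
  have := ler_wpM2r (mulr_ge0 (ltW (mulr_gt0 eta_gt0 w0)) s0) wL; lra.
(* The square behind 2 r e <= r^2 / 3 + 3 e^2. *)
have h3 : 0 <= eta * w * (r - 3 * e) ^+ 2 by rewrite mulr_ge0 ?sqr_ge0// ltW// mulr_gt0.
lra.
Qed.

End ClippedStep.

(** * Scalar recursion *)

Section TwoPhaseRate.
Context {R : realType} (u : nat -> R) (b sigma Q : R).
Hypotheses (u_ge0 : forall k, 0 <= u k) (b_gt0 : 0 < b) (sigma_ge0 : 0 <= sigma).
Hypotheses (Q_ge0 : 0 <= Q) (Q_le1 : Q <= 1) (Q_rate : 1 - b * sigma <= Q).
Hypothesis u_step : forall k s, 0 <= s -> s <= sigma ->
  u k.+1 + 2 * b * s * u k <= u k + b * s ^+ 2.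

(** The index j counts the steps with u > sigma, each of which multiplies u by
    at most Q; the k - j others each add at least b to 1 / u. The bound on 1 / u
    is written as a product, so that u = 0 is covered. *)
Lemma two_phase_count k : exists2 j, (j <= k)%N &
  u k <= Q ^+ j * u 0%N /\ b * u k * (k - j)%:R <= 1.
Proof.
elim: k => [|k [j jk [uQ ub]]].
  by exists 0%N => //; rewrite expr0 mul1r subnn mulr0.
have uk := u_ge0 k; have uk1 := u_ge0 k.+1.
have buk := mulr_ge0 (ltW b_gt0) uk.
have buk1 := mulr_ge0 (ltW b_gt0) uk1.
have [small|/ltW large] := leP (u k) sigma.
  have dec : u k.+1 <= u k - b * (u k) ^+ 2 by have := @u_step k (u k) uk small; lra.
  have le1 : u k.+1 <= u k.
    by apply: le_trans dec _; rewrite gerBl mulr_ge0 ?sqr_ge0// ltW.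
  exists j; first exact: leqW.
  split; first exact: le_trans uQ.
  rewrite subSn// -natr1 mulrDr mulr1.
  set n := (k - j)%:R : R in ub *.
  have n0 : 0 <= n by exact: ler0n.
  have [bu1|/ltW bu1] := leP (b * u k) 1; last first.
    have : u k.+1 <= 0.
      apply: le_trans dec _; rewrite expr2 mulrA subr_le0.
      by rewrite -[leLHS]mul1r ler_wpM2r.
    move=> uk1'; have -> : u k.+1 = 0 by apply/eqP; rewrite eq_le uk1' uk1.
    by rewrite !(mulr0, mul0r) addr0.
  have bdec : b * u k.+1 <= b * u k * (1 - b * u k).
    by apply: le_trans (_ : _ <= b * (u k - b * u k ^+ 2)) _; [rewrite ler_pM2l|lra].
  have h1 : b * u k.+1 * (n + 1) <= b * u k * (1 - b * u k) * (n + 1).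
    by rewrite ler_wpM2r// addr_ge0.
  have h2 : b * u k * n * (1 - b * u k) <= 1 * (1 - b * u k).
    by rewrite ler_wpM2r// subr_ge0.
  have := sqr_ge0 (b * u k); lra.
have dec : u k.+1 <= Q * u k.
  have h1 : (1 - b * sigma) * u k <= Q * u k by rewrite ler_wpM2r.
  have h2 : b * sigma * sigma <= b * sigma * u k.
    by rewrite ler_wpM2l// mulr_ge0// ltW.
  have := @u_step k sigma sigma_ge0 (lexx _); lra.
exists j.+1 => //; split.
  by apply: le_trans dec _; rewrite exprS -mulrA ler_wpM2l.
rewrite subSS; apply: le_trans ub; rewrite ler_wpM2r ?ler0n// ler_pM2l//.
by apply: le_trans dec _; rewrite ler_piMl.
Qed.

Lemma two_phase_rate N :
  u N <= Num.max (Q `^ (N%:R / 2) * u 0%N) (2 / (b * N%:R)).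
Proof.
have [j jN [uQ ub]] := two_phase_count N; rewrite le_max.
have [Nj|jN2] := leqP N (j * 2).
  apply/orP; left; apply: le_trans uQ _; rewrite ler_wpM2r//.
  have Nj2 : N%:R / 2 <= j%:R :> R by rewrite ler_pdivrMr// -natrM ler_nat.
  rewrite -powR_mulrn//; have [Q0|Q0] := eqVneq Q 0; last first.
    by apply: ger_powR => //; rewrite lt_def Q0 Q_ge0 Q_le1.
  have [j0|j0] := eqVneq j 0%N.
    by move: Nj; rewrite j0 leqn0 => /eqP ->; rewrite mul0r.
  by rewrite Q0 powR0 ?powR_ge0// pnatr_eq0.
apply/orP; right.
have N0 : (0 < N)%N by apply: leq_ltn_trans jN2.
rewrite ler_pdivlMr ?mulr_gt0 ?ltr0n//.
have : N%:R <= 2 * (N - j)%:R :> R.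
  rewrite -natrM ler_nat mulnBr leq_subRL; last by rewrite leq_mul2l.
  by rewrite [leqRHS]mul2n -addnn leq_add2r mulnC ltnW.
have := mulr_ge0 (ltW b_gt0) (u_ge0 N) => bu.
move=> /(ler_wpM2l bu); lra.
Qed.

End TwoPhaseRate.

(** In the variables h = F / D and t = s / D the claim is
    2 t h - t^2 <= h min(c, h): the left-hand side is the tangent at t of the
    square, and for 2 t <= c it also stays below c h. *)
Lemma huber_tangent (R : realType) (eta c D F s : R) :
  0 < eta -> 0 < c -> 0 < D -> 0 <= F -> 0 <= s -> s <= c * D / 2 ->
  2 * (eta / (3 * D ^+ 2)) * s * F <=
  eta / 3 * (F / D * Num.min c (F / D)) + eta / (3 * D ^+ 2) * s ^+ 2.
Proof.
move=> eta0 c0 D0 F0 s0 sc.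
have Dn0 : D != 0 by rewrite gt_eqF.
set h := F / D; set t := s / D.
have hF : F = h * D by rewrite /h divfK.
have ts : s = t * D by rewrite /t divfK.
have h0 : 0 <= h by rewrite divr_ge0// ltW.
have t0 : 0 <= t by rewrite divr_ge0// ltW.
have tc : t <= c / 2 by rewrite ler_pdivrMr// mulrAC.
have -> : 2 * (eta / (3 * D ^+ 2)) * s * F = eta / 3 * (2 * t * h).
  by rewrite ts hF; field.
have -> : eta / (3 * D ^+ 2) * s ^+ 2 = eta / 3 * t ^+ 2 by rewrite ts; field.
rewrite -mulrDr ler_pM2l ?divr_gt0//.
have [ch|hc] := leP c h; last by have := sqr_ge0 (h - t); lra.
have : 0 <= h * (c - 2 * t) by rewrite mulr_ge0//; lra.
by have := sqr_ge0 t; lra.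
Qed.

(** * Measurability of gradients along random points *)

(** Measurability is required coordinatewise, which avoids choosing a
    sigma-algebra on the space of row vectors. *)
Definition measurable_row (R : realType) (d : nat) (disp : measure_display)
    (S : measurableType disp) (y : S -> 'rV[R]_d) : Prop :=
  forall i, measurable_fun [set: S] (fun s => y s ord0 i).

Section Caratheodory.
Context {R : realType} {d : nat} {dT dS : measure_display}.
Context {T : measurableType dT} {S : measurableType dS}.

(** A point is rounded to the grid of mesh 1 / (n + 1); the integer vector
    [grid_index n x] names its grid cell. *)
Definition grid_index (n : nat) (x : 'rV[R]_d) : 'rV[int]_d :=
  \row_i Num.floor (n.+1%:R * x ord0 i).

Definition grid_point (n : nat) (v : 'rV[int]_d) : 'rV[R]_d :=
  \row_i ((v ord0 i)%:~R / n.+1%:R).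

Lemma grid_point_cvg (x : 'rV[R]_d) :
  grid_point n (grid_index n x) @[n --> \oo] --> x.
Proof.
apply/cvg_ballP => e e0; near=> n; split => // i j; rewrite ord1 !mxE.
rewrite /ball /=; set a := n.+1%:R * x ord0 j.
have n0 : 0 < n.+1%:R :> R by rewrite ltr0n.
have -> : x ord0 j - (Num.floor a)%:~R / n.+1%:R = (a - (Num.floor a)%:~R) / n.+1%:R.
  by rewrite mulrBl /a mulrAC divff ?mul1r// gt_eqF.
have /andP[fa af] := floor_itv a.
rewrite normrM normfV (ger0_norm (ltW n0)) ger0_norm ?subr_ge0//.
apply: (@le_lt_trans _ _ (n.+1%:R^-1)); last first.
  by near: n; exact: (near_infty_natSinv_lt (PosNum e0)).
rewrite ler_piMl ?invr_ge0 ?(ltW n0)//.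
by rewrite intrD in af; lra.
Unshelve. all: by end_near. Qed.

Variables (h : 'rV[R]_d -> T -> R).
Hypotheses (h_cont : forall t, continuous (h^~ t))
  (h_meas : forall x, measurable_fun [set: T] (h x)).
Variables (y : S -> 'rV[R]_d) (tau : S -> T).
Hypotheses (y_meas : measurable_row y) (tau_meas : measurable_fun [set: S] tau).

Lemma measurable_grid_index n v : measurable [set s | grid_index n (y s) = v].
Proof.
rewrite (_ : [set s | _] = \bigcap_(i in [set: 'I_d])
    ((fun s => n.+1%:R * y s ord0 i) @^-1`
       [set` `[(v ord0 i)%:~R, (v ord0 i + 1)%:~R[%R])).
  apply: fin_bigcap_measurable => // i _.
  rewrite -[X in measurable X]setTI.
  by apply: measurable_funM => //; exact: measurable_itv.
apply/seteqP; split => s /=.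
  by move=> <- i _ /=; rewrite mxE in_itv /= floor_itv.
move=> sv; apply/rowP => i; rewrite mxE; apply/eqP; rewrite floor_eq.
by have := sv i I; rewrite /= in_itv.
Qed.

Lemma measurable_comp_grid n :
  measurable_fun [set: S] (fun s => h (grid_point n (grid_index n (y s))) (tau s)).
Proof.
move=> _ A mA; rewrite setTI.
rewrite (_ : _ @^-1` _ = \bigcup_v ([set s | grid_index n (y s) = v] `&`
    ((h (grid_point n v) \o tau) @^-1` A))).
  apply: countable_bigcupT_measurable => // v; apply: measurableI.
    exact: measurable_grid_index.
  rewrite -[X in measurable X]setTI.
  by apply: (measurableT_comp (h_meas _) tau_meas).
by apply/seteqP; split => s /= => [As|[v _ [<-]]//]; exists (grid_index n (y s)).
Qed.

(** Rounding y makes the first argument of h take countably many values, so the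
    rounded composition is measurable; continuity of h in that argument lets the
    mesh go to zero. *)
Lemma measurable_caratheodory : measurable_fun [set: S] (fun s => h (y s) (tau s)).
Proof.
apply: (measurable_fun_cvg
  (h := fun n s => h (grid_point n (grid_index n (y s))) (tau s))).
  exact: measurable_comp_grid.
move=> s _; apply: (@cvg_comp _ _ _ (fun n => grid_point n (grid_index n (y s)))
  (h^~ (tau s)) _ _ _ (@grid_point_cvg (y s))).
exact: h_cont.
Qed.

End Caratheodory.

Section MeasurableGradient.
Context {R : realType} {d : nat} {dT dS : measure_display}.
Context {T : measurableType dT} {S : measurableType dS}.

Lemma derive_cvg_harmonic (g : 'rV[R]_d -> R) x v : derivable g x v ->
  n.+1%:R * (g (n.+1%:R^-1 *: v + x) - g x) @[n --> \oo] --> 'D_v g x.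
Proof.
move=> dg; have h0 : harmonic @ \oo --> (0 : R)^'.
  move=> A A0; have := @cvg_harmonic R _ A0; rewrite !nbhs_filterE /=.
  apply: filterS => n; apply; rewrite /harmonic /= invr_neq0// pnatr_eq0//.
have := cvg_comp _ _ h0 dg; apply: cvg_trans; apply: near_eq_cvg; near=> n.
by rewrite /= /harmonic invrK.
Unshelve. all: by end_near. Qed.

Variables (h : 'rV[R]_d -> T -> R).
Hypotheses (h_diff : forall t x, differentiable (h^~ t) x)
  (h_meas : forall x, measurable_fun [set: T] (h x)).
Variables (y : S -> 'rV[R]_d) (tau : S -> T).
Hypotheses (y_meas : measurable_row y) (tau_meas : measurable_fun [set: S] tau).

(** Partial derivatives are limits of difference quotients along the steps
    1 / (n + 1), to which [measurable_caratheodory] applies. *)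
Lemma measurable_grad : measurable_row (fun s => grad (h^~ (tau s)) (y s)).
Proof.
move=> i; under eq_fun do rewrite mxE.
have hc t : continuous (h^~ t) by move=> x; exact: differentiable_continuous.
apply: (measurable_fun_cvg (h := fun n s => n.+1%:R *
    (h (n.+1%:R^-1 *: delta_mx ord0 i + y s) (tau s) - h (y s) (tau s)))).
  move=> n; apply: measurable_funM => //; apply: measurable_funB.
    apply: measurable_caratheodory => //.
    by move=> j; under eq_fun do rewrite mxE; exact: measurable_funD.
  exact: measurable_caratheodory.
by move=> s _; apply: derive_cvg_harmonic; exact: diff_derivable.
Qed.

End MeasurableGradient.

Lemma grad_at_min (R : realType) (d : nat) (g : 'rV[R]_d -> R) x :
  (forall z, differentiable g z) -> (forall z, g x <= g z) -> grad g x = 0.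
Proof.
move=> dg gmin; apply/rowP => i; rewrite !mxE.
set v := delta_mx _ _.
have dgl (t : R) : derivable (fun r : R => g (r *: v + x)) t 1.
  by apply/diff_derivable; apply: (differentiable_comp (f := fun r : R => r *: v + x)).
have : is_derive (0 : R) 1 (fun r : R => g (r *: v + x)) 0.
  apply: (@derive1_at_min R _ (-1) 1) => //.
  - by rewrite in_itv /= ltrN10 ltr01.
  - by move=> t _; rewrite scale0r add0r.
move=> dg0; transitivity ('D_1 (fun r : R => g (r *: v + x)) 0); last by case: dg0.
rewrite /derive; set a := (X in lim (X @ _)); set b := (X in _ = lim (X @ _)).
suff -> : a = b by [].
by apply/funext => t; rewrite /a /b /= addr0 scale0r add0r [_%:A]mulr1.
Qed.

Section MeasurableRows.
Context {R : realType} {d : nat} {dS : measure_display} {S : measurableType dS}.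
Implicit Types (u v : S -> 'rV[R]_d) (a : S -> R).

Lemma measurable_row_cst (x : 'rV[R]_d) : measurable_row (fun _ : S => x).
Proof. by move=> i; exact: measurable_cst. Qed.

Lemma measurable_rowD u v : measurable_row u -> measurable_row v ->
  measurable_row (fun s => u s + v s).
Proof. by move=> mu mv i; under eq_fun do rewrite mxE; exact: measurable_funD. Qed.

Lemma measurable_rowZ a u : measurable_fun [set: S] a -> measurable_row u ->
  measurable_row (fun s => a s *: u s).
Proof. by move=> ma mu i; under eq_fun do rewrite mxE; exact: measurable_funM. Qed.

Lemma measurable_rowN u : measurable_row u -> measurable_row (fun s => - u s).
Proof.
move=> mu; under eq_fun do rewrite -scaleN1r.
by apply: measurable_rowZ => //; exact: measurable_cst.
Qed.

Lemma measurable_row_sum (I : Type) (r : seq I) (F : I -> S -> 'rV[R]_d) :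
  (forall i, measurable_row (F i)) -> measurable_row (fun s => \sum_(i <- r) F i s).
Proof.
by move=> mF i; under eq_fun do rewrite summxE; apply: measurable_sum => j; exact: mF.
Qed.

Lemma measurable_dotp u v : measurable_row u -> measurable_row v ->
  measurable_fun [set: S] (fun s => dotp (u s) (v s)).
Proof.
by move=> mu mv; apply: measurable_sum => i; apply: measurable_funM; [exact: mu|exact: mv].
Qed.

Lemma measurable_enorm u : measurable_row u ->
  measurable_fun [set: S] (fun s => enorm (u s)).
Proof.
move=> mu; apply: (measurableT_comp _ (measurable_dotp mu mu)).
apply: continuous_measurable_fun; exact: sqrt_continuous.
Qed.

Lemma measurable_clip_weight c a : 0 < c -> measurable_fun [set: S] a ->
  measurable_fun [set: S] (fun s => clip_weight c (a s)).
Proof.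
move=> c0 ma.
rewrite (_ : (fun _ => _) = fun s => c * (Num.max c (a s)) `^ (-1)); last first.
  by apply/funext => s; rewrite powR_inv1// le_max (ltW c0).
apply: measurable_funM => //.
apply: (measurableT_comp (measurable_powR (-1))).
exact: measurable_maxr.
Qed.

End MeasurableRows.

(** * Independence of a sample from the past *)

Section Past.
Context {R : realType} {dO dT : measure_display}.
Context {Omega : measurableType dO} {T : measurableType dT}.
Context {P : probability Omega R} {D : probability T R}.
Context {I : choiceType} (X : I -> {RV P >-> T}) (J : seq I).

(** The events prescribed by finitely many conditions on the samples indexed by J;
    they form a pi-system. *)
Definition cylinders : set (set Omega) :=
  [set E | exists2 A : I -> set T, (forall i, measurable (A i)) &
    E = \bigcap_(i in [set` J]) (X i @^-1` A i)].

(** The sample space with the sigma-algebra generated by the samples of J. The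
    identity into it plays the role of the random vector of these samples. *)
Definition past := g_sigma_algebraType cylinders.

Lemma cylinders_measurable : cylinders `<=` measurable.
Proof.
move=> _ [A mA ->]; apply: fin_bigcap_measurable => // i _.
exact: measurable_funPTI.
Qed.

Lemma setI_closed_cylinders : setI_closed cylinders.
Proof.
move=> _ _ [A mA ->] [B mB ->]; exists (fun i => A i `&` B i).
  by move=> i; exact: measurableI.
by apply/seteqP; split => w /=; [move=> [a b] i iJ; split; [exact: a|exact: b]
  |move=> ab; split => i iJ; case: (ab i iJ)].
Qed.

Lemma measurable_past (E : set past) : measurable E -> measurable (E : set Omega).
Proof.
apply: smallest_sub; last exact: cylinders_measurable.
exact: sigma_algebra_measurable.
Qed.

Lemma measurable_id_past : measurable_fun [set: Omega] (id : Omega -> past).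
Proof. by move=> _ E mE; rewrite setTI; exact: measurable_past. Qed.

Lemma measurable_past_var j : j \in J -> measurable_fun [set: past] (X j : past -> T).
Proof.
move=> jJ _ A mA; rewrite setTI; apply: sub_sigma_algebra.
exists (fun i => if i == j then A else setT).
  by move=> i; case: ifP.
apply/seteqP; split => w /=; first by move=> Aw i _; case: eqVneq => [->|].
by move=> /(_ j jJ); rewrite /= eqxx.
Qed.

Hypotheses (X_iid : iid D X) (J_uniq : uniq J).
Variables (i0 : I) (i0J : i0 \notin J).

(** For fixed C both sides are finite measures in E that agree on the cylinders,
    by mutual independence of the samples of J together with i0. *)
Lemma past_independent (E : set past) (C : set T) : measurable E -> measurable C ->
  P ((E : set Omega) `&` X i0 @^-1` C) = (P E * D C)%E.
Proof.
move=> mE mC; have [Xlaw Xind] := X_iid.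
have mXC : measurable (X i0 @^-1` C) by exact: measurable_funPTI.
have DC : P (X i0 @^-1` C) = D C by rewrite -(Xlaw i0 C mC).
have DCfin : D C \is a fin_num by exact: fin_num_measure.
have r0 : 0 <= fine (D C) by rewrite fine_ge0.
pose m2 := mscale (NngNum r0) P.
have GE : [set Y | cylinders Y /\ Y `<=` setT] = cylinders.
  by apply/seteqP; split => [Y []|Y CY]//=; split.
suff : mrestr P mXC E = m2 E by rewrite /mrestr /m2 /mscale /= fineK// muleC.
apply: (g_sigma_algebra_measure_unique_trace cylinders setT) => //=; rewrite ?GE//.
- exact: cylinders_measurable.
- exact: setI_closed_cylinders.
- by rewrite /mrestr /mscale /= setTI fineK// probability_setT mule1.
- move=> _ [[A mA ->] _]; rewrite /mrestr /mscale /= fineK//.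
  pose B i := if i == i0 then C else A i.
  have mB i : measurable (B i) by rewrite /B; case: ifP.
  have BA i : i \in J -> B i = A i.
    by rewrite /B; case: eqVneq => // ->; rewrite (negbTE i0J).
  rewrite (Xind J A)// -DC.
  transitivity (P (\bigcap_(i in [set` i0 :: J]) (X i @^-1` B i))).
    congr (P _); apply/seteqP; split => w /=.
      move=> [Aw Cw] i /=; rewrite inE => /predU1P[->|iJ].
        by rewrite /B eqxx.
      by rewrite BA//; exact: Aw.
    move=> Bw; split => [i /= iJ|].
      by have := Bw i; rewrite /= inE iJ orbT BA//; apply.
    by have := Bw i0; rewrite /= inE eqxx /B eqxx; apply.
  rewrite (Xind (i0 :: J) B)//=; last by rewrite i0J.
  rewrite big_cons {1}/B eqxx; congr (_ * _)%E.
  by apply: eq_big_seq => i iJ; rewrite BA.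
- by rewrite /mrestr setTI (le_lt_trans (probability_le1 _ _))// ltry.
Qed.

(** The joint law of the past and the fresh sample is a product measure by
    [past_independent], so Tonelli integrates the fresh sample out first. *)
Lemma integral_past (h : past * T -> \bar R) :
  measurable_fun [set: past * T] h -> (forall z, 0 <= h z)%E ->
  (\int[P]_w h ((w : past), X i0 w) = \int[P]_w \int[D]_t h ((w : past), t))%E.
Proof.
move=> mh h0.
pose pid : {mfun Omega >-> past} :=
  HB.pack (id : Omega -> past) (isMeasurableFun.Build _ _ _ _ _ measurable_id_past).
have mpair : measurable_fun [set: Omega] (fun w => ((w : past), X i0 w)).
  by apply: measurable_fun_pair; [exact: measurable_id_past|exact: measurable_funP].
pose pair : {mfun Omega >-> (past * T)%type} :=
  HB.pack (fun w : Omega => ((w : past), X i0 w)) (isMeasurableFun.Build _ _ _ _ _ mpair).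
rewrite -(@ge0_integral_distribution _ _ _ _ _ P pair h)//.
transitivity (\int[distribution P pid \x D]_z h z)%E.
  apply: eq_measure_integral => /= E mE _; apply/esym.
  apply: product_measure_unique => // A B mA mB.
  exact: past_independent.
rewrite fubini_tonelli1//.
rewrite (@ge0_integral_distribution _ _ _ _ _ P pid)//.
- exact: measurable_fun_fubini_tonelli_F.
- by move=> w; exact: integral_ge0.
Qed.

End Past.

(** * Means *)

(** Bundling integrability with the value of the integral lets real means be
    computed without side conditions in the extended reals. *)
Definition has_mean (R : realType) (disp : measure_display) (S : measurableType disp)
    (mu : probability S R) (u : S -> R) (m : R) : Prop :=
  mu.-integrable [set: S] (EFin \o u) /\ (\int[mu]_s (u s)%:E)%E = m%:E.

Section HasMean.
Context {R : realType} {disp : measure_display} {S : measurableType disp}.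
Context {mu : probability S R}.
Implicit Types (u v : S -> R) (a m n : R).

Lemma has_mean_measurable u m : has_mean mu u m -> measurable_fun [set: S] u.
Proof. by move=> [/measurable_int/measurable_EFinP]. Qed.

Lemma has_mean_cst a : has_mean mu (fun _ => a) a.
Proof.
split; first exact: finite_measure_integrable_cst.
by rewrite integral_cst//= probability_setT mule1.
Qed.

Lemma has_meanD u v m n : has_mean mu u m -> has_mean mu v n ->
  has_mean mu (fun s => u s + v s) (m + n).
Proof.
move=> [iu mu_] [iv mv]; split; first exact: (integrableD measurableT iu iv).
by rewrite -[LHS]/(\int[mu]_s ((u s)%:E + (v s)%:E))%E integralD// mu_ mv.
Qed.

Lemma has_meanZ a u m : has_mean mu u m -> has_mean mu (fun s => a * u s) (a * m).
Proof.
move=> [iu mu_]; split; first exact: (integrableZl measurableT a iu).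
by rewrite -[LHS]/(\int[mu]_s (a%:E * (u s)%:E))%E integralZl// mu_.
Qed.

Lemma has_mean_sum (I : Type) (r : seq I) (u : I -> S -> R) (m : I -> R) :
  (forall i, has_mean mu (u i) (m i)) ->
  has_mean mu (fun s => \sum_(i <- r) u i s) (\sum_(i <- r) m i).
Proof.
move=> um; elim: r => [|i r IH].
  rewrite big_nil; under eq_fun do rewrite big_nil; exact: has_mean_cst.
rewrite big_cons; under eq_fun do rewrite big_cons; exact: has_meanD.
Qed.

Lemma has_mean_le u v m n : has_mean mu u m -> has_mean mu v n ->
  {ae mu, forall s, u s <= v s} -> m <= n.
Proof.
move=> um vn uv; rewrite -subr_ge0.
have [iw] : has_mean mu (fun s => v s - u s) (n - m).
  rewrite -mulN1r; under eq_fun do rewrite -mulN1r.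
  by apply: has_meanD => //; exact: has_meanZ.
have mw : measurable_fun [set: S] (fun s => v s - u s).
  by apply: measurable_funB; [exact: has_mean_measurable vn|exact: has_mean_measurable um].
have -> : (\int[mu]_s (v s - u s)%:E = \int[mu]_s `|v s - u s|%:E)%E.
  apply: ae_eq_integral => //; try exact/measurable_EFinP.
    by apply/measurable_EFinP; exact: measurableT_comp.
  by apply: filterS uv => s uvs _; rewrite ger0_norm// subr_ge0.
move=> nm; rewrite -lee_fin -nm; apply: integral_ge0 => s _.
by rewrite lee_fin.
Qed.

Lemma ge0_has_mean u (b : R) : measurable_fun [set: S] u -> (forall s, 0 <= u s) ->
  (\int[mu]_s (u s)%:E <= b%:E)%E -> exists2 m, m <= b & has_mean mu u m.
Proof.
move=> mu_ u0 ub.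
have i0 : (0 <= \int[mu]_s (u s)%:E)%E by apply: integral_ge0 => s _; rewrite lee_fin.
have ifin : (\int[mu]_s (u s)%:E)%E \is a fin_num.
  by rewrite ge0_fin_numE// (le_lt_trans ub)// ltry.
exists (fine (\int[mu]_s (u s)%:E)%E); first by rewrite -lee_fin fineK.
split; last by rewrite fineK.
apply/integrableP; split; first exact/measurable_EFinP.
rewrite (eq_integral (fun s => (u s)%:E)); last by move=> s _; rewrite /= ger0_norm.
by rewrite (le_lt_trans ub)// ltry.
Qed.

Lemma ge0_has_mean_dominated u v n : measurable_fun [set: S] u ->
  (forall s, 0 <= u s) -> (forall s, 0 <= v s) ->
  {ae mu, forall s, u s <= v s} -> has_mean mu v n -> exists m, has_mean mu u m.
Proof.
move=> mu_ u0 v0 uv vn.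
have mv := has_mean_measurable vn.
suff /(ge0_has_mean mu_ u0)[m _ um] : (\int[mu]_s (u s)%:E <= n%:E)%E by exists m.
have mm : measurable_fun [set: S] (fun s => Num.min (u s) (v s)) by exact: measurable_minr.
have -> : (\int[mu]_s (u s)%:E = \int[mu]_s (Num.min (u s) (v s))%:E)%E.
  apply: ge0_ae_eq_integral => //; try exact/measurable_EFinP.
  - by move=> s _; rewrite lee_fin.
  - by move=> s _; rewrite lee_fin le_min u0 v0.
  - by apply: filterS uv => s uvs _; rewrite (min_idPl uvs).
have [_ <-] := vn; apply: ge0_le_integral => //; try exact/measurable_EFinP.
- by move=> s _; rewrite lee_fin le_min u0 v0.
- by move=> s _; rewrite lee_fin ge_min lexx orbT.
Qed.

Lemma ae_eq0_of_mean0 u : measurable_fun [set: S] u -> (forall s, 0 <= u s) ->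
  has_mean mu u 0 -> {ae mu, forall s, u s = 0}.
Proof.
move=> mu_ u0 [_ um]; have /ae_eq_integral_abs : measurable_fun [set: S] (EFin \o u).
  exact/measurable_EFinP.
move=> /(_ mu measurableT)[+ _].
rewrite (eq_integral (fun s => (u s)%:E)); last by move=> s _; rewrite /= ger0_norm.
by move=> /(_ um); apply: filterS => s /(_ I)[].
Qed.

End HasMean.

(** * The stochastic oracle *)

Definition good_sample (R : realType) (d : nat) (T : Type) (f : 'rV[R]_d -> T -> R)
    (H0 H1 : R) (xs : 'rV[R]_d) (z : T) : Prop :=
  [/\ H0H1_smooth H0 H1 (f^~ z), grad_convex (f^~ z) & forall x, f xs z <= f x z].

Section Oracle.
Context {R : realType} {d : nat} {dT : measure_display} {T : measurableType dT}.
Context {D : probability T R} (f : 'rV[R]_d -> T -> R) (H0 H1 rho : R).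
Variable xs : 'rV[R]_d.
Hypothesis f_int : forall x, D.-integrable [set: T] (fun z => (f x z)%:E).
Hypothesis f_diff : forall z x, differentiable (f^~ z) x.
Hypothesis F_diff : forall x, differentiable (objective D f) x.
Hypothesis F_min : forall x, objective D f xs <= objective D f x.
Hypothesis f_ae : {ae D, forall z, H0H1_smooth H0 H1 (f^~ z) /\ grad_convex (f^~ z)}.
Hypothesis f_unbiased : unbiased_oracle D f.
Hypothesis f_growth : strong_growth D f rho.

Local Notation F := (objective D f).
Local Notation G := (grad (objective D f)).

Lemma has_mean_value x : has_mean D (f x) (F x).
Proof.
split; first exact: f_int.
rewrite /objective unlock fineK//.
exact: (integrable_fin_num measurableT (f_int x)).
Qed.

Lemma measurable_value x : measurable_fun [set: T] (f x).
Proof. exact: has_mean_measurable (has_mean_value x). Qed.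

Lemma measurable_sample_grad x : measurable_row (fun z => grad (f^~ z) x).
Proof.
apply: (measurable_grad f_diff measurable_value (y := fun=> x) (tau := id)).
  exact: measurable_row_cst.
exact: measurable_id.
Qed.

Lemma has_mean_sqr_grad x : exists2 m, m <= rho * enorm (G x) ^+ 2 &
  has_mean D (fun z => enorm (grad (f^~ z) x) ^+ 2) m.
Proof.
apply: ge0_has_mean.
- by apply: measurable_funX; apply: measurable_enorm; exact: measurable_sample_grad.
- by move=> z; exact: sqr_ge0.
- by have := f_growth x; rewrite unlock.
Qed.

(** Integrability comes from the second moment, since |g| <= 1 + ||g||^2. *)
Lemma has_mean_grad_coord x i : has_mean D (fun z => grad (f^~ z) x ord0 i) (G x ord0 i).
Proof.
split; last by have := f_unbiased x i; rewrite unlock.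
have [m _ gm] := has_mean_sqr_grad x.
have [g1 _] := has_meanD gm (has_mean_cst 1).
apply: le_integrable g1 => //.
  by apply/measurable_EFinP; exact: measurable_sample_grad.
move=> z _ /=; rewrite lee_fin.
rewrite [leRHS]ger0_norm ?addr_ge0 ?sqr_ge0//.
apply: le_trans (enorm_coord _ _) _.
have := sqr_ge0 (enorm (grad (f^~ z) x) - 1); have := sqr_ge0 (enorm (grad (f^~ z) x)).
by rewrite !expr2; lra.
Qed.

Lemma has_mean_grad x v : has_mean D (fun z => dotp (grad (f^~ z) x) v) (dotp (G x) v).
Proof.
apply: has_mean_sum => i; rewrite mulrC; under eq_fun do rewrite mulrC.
exact/has_meanZ/has_mean_grad_coord.
Qed.

(** The oracle is centred, so the noise is orthogonal to the deterministic shift s,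
    and its variance is at most (rho - 1) ||G||^2 by strong growth. *)
Lemma mean_sqr_shifted x s : (\int[D]_z (enorm (s + (grad (f^~ z) x - G x)) ^+ 2)%:E
  <= (enorm s ^+ 2 + (rho - 1) * enorm (G x) ^+ 2)%:E)%E.
Proof.
have [m mle gm] := has_mean_sqr_grad x.
have [_] := has_meanD (has_meanD gm (has_meanZ 2 (has_mean_grad x (s - G x))))
  (has_mean_cst (enorm (s - G x) ^+ 2)).
under eq_integral do rewrite /=.
rewrite (eq_integral (fun z => (enorm (s + (grad (f^~ z) x - G x)) ^+ 2)%:E)); last first.
  move=> z _; rewrite !enorm_sqr !dotpE; congr (_%:E).
  move: (grad (f^~ z) x) (G x) => a b.
  by rewrite (dotpC s a) (dotpC b a) (dotpC s b); ring.
move=> ->; rewrite lee_fin !enorm_sqr !dotpE in mle *.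
by rewrite (dotpC s (G x)); lra.
Qed.

(** Interpolation: at xs the right-hand side of strong growth is zero, so almost
    every sample gradient vanishes there and convexity makes xs a minimiser. *)
Lemma ae_good_sample : {ae D, forall z, good_sample f H0 H1 xs z}.
Proof.
have gxs : G xs = 0 by exact: grad_at_min.
have [m mle gm] := has_mean_sqr_grad xs.
have m0 : m = 0.
  apply/eqP; rewrite eq_le; apply/andP; split.
    by move: mle; rewrite gxs enorm0 expr0n mulr0.
  by apply: has_mean_le (has_mean_cst 0) gm _; apply: aeW => z; exact: sqr_ge0.
rewrite m0 in gm.
have := ae_eq0_of_mean0 (has_mean_measurable gm) (fun z => sqr_ge0 _) gm.
apply: filterS2 f_ae => z [sz cz] /eqP; rewrite expf_eq0 /= => /eqP/enorm0_eq0 gz.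
by split => // x; have := cz xs x; rewrite gz dotp0l addr0.
Qed.

Lemma objective_convex x : F x - F xs <= dotp (G x) (x - xs).
Proof.
rewrite -mulN1r; apply: (has_mean_le (mu := D)).
- exact: has_meanD (has_mean_value x) (has_meanZ (-1) (has_mean_value xs)).
- exact: has_mean_grad.
apply: filterS ae_good_sample => z [_ cz _]; rewrite mulN1r.
exact: (convex_gap (g := f^~ z)).
Qed.

Lemma objective_descent x y : Num.sqrt H1 * enorm (y - x) <= 1 ->
  F y <= F x + dotp (G x) (y - x) + (H0 + H1 * (F x - F xs)) * enorm (y - x) ^+ 2.
Proof.
move=> yx; rewrite -[- F xs]mulN1r [_ * enorm _ ^+ 2]mulrC.
apply: (has_mean_le (mu := D)).
- exact: has_mean_value.
- apply: has_meanD.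
    exact: has_meanD (has_mean_value x) (has_mean_grad x (y - x)).
  apply/has_meanZ/has_meanD; first exact: has_mean_cst.
  exact/has_meanZ/(has_meanD (has_mean_value x))/has_meanZ/has_mean_value.
apply: filterS ae_good_sample => z [sz cz mz].
rewrite mulN1r [_ ^+ 2 * _]mulrC.
exact: (convex_smooth_descent (g := f^~ z)).
Qed.

End Oracle.

(** * Batches and iterates *)

Section Batch.
Context {R : realType} {d : nat} {T : Type} (f : 'rV[R]_d -> T -> R) (H0 H1 : R).
Context (xs : 'rV[R]_d) {B : nat} (s : 'I_B -> T).
Hypothesis B_gt0 : (0 < B)%N.
Hypothesis s_good : forall i, good_sample f H0 H1 xs (s i).

Definition batch_gap (x : 'rV[R]_d) : R :=
  B%:R^-1 * \sum_i (f x (s i) - f xs (s i)).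

Let B0 : 0 < B%:R :> R.
Proof. by rewrite ltr0n. Qed.

Lemma batch_gap_ge0 x : 0 <= batch_gap x.
Proof.
rewrite mulr_ge0 ?invr_ge0 ?ler0n// sumr_ge0// => i _.
by rewrite subr_ge0; case: (s_good i).
Qed.

Lemma batch_gap_convex x : batch_gap x <= dotp (batch_grad f s x) (x - xs).
Proof.
rewrite dotpZl dotp_suml ler_pM2l ?invr_gt0//; apply: ler_sum => i _.
by case: (s_good i) => _ cz _; exact: (convex_gap (g := f^~ (s i))).
Qed.

Lemma batch_gap_descent x p : Num.sqrt H1 * enorm p <= 1 ->
  0 <= batch_gap x - dotp (batch_grad f s x) p
       + (H0 + H1 * batch_gap x) * enorm p ^+ 2.
Proof.
move=> p_short; rewrite -(pmulr_rge0 _ B0).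
pose u i := f x (s i) - f xs (s i); pose v i := dotp (grad (f^~ (s i)) x) p.
have -> : B%:R * (batch_gap x - dotp (batch_grad f s x) p
       + (H0 + H1 * batch_gap x) * enorm p ^+ 2) =
  \sum_i (u i - v i + (H0 + H1 * u i) * enorm p ^+ 2).
  transitivity (\sum_i u i - \sum_i v i + (\sum_(i < B) H0 + H1 * \sum_i u i) * enorm p ^+ 2).
    rewrite /batch_gap dotpZl dotp_suml sumr_const card_ord -[H0 *+ B]mulr_natr.
    by field; rewrite gt_eqF.
  by rewrite mulr_sumr -sumrB -big_split /= mulr_suml -big_split.
rewrite /u /v {u v}.
apply: sumr_ge0 => i _; case: (s_good i) => sz cz mz.
have := @convex_smooth_descent _ _ H0 H1 (f^~ (s i)) xs cz sz mz x (x - p).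
rewrite addrAC subrr add0r enormN dotpNr => /(_ p_short).
by have := mz (x - p); lra.
Qed.

End Batch.

Section Iteration.
Context {R : realType} {d : nat} {T : Type} (f : 'rV[R]_d -> T -> R).
Context {B : nat} (eta c : R) (x0 : 'rV[R]_d) (s : nat -> 'I_B -> T).
Hypothesis c_gt0 : 0 < c.

Lemma clip_sgdS k : clip_sgd f eta c x0 s k.+1 =
  clip_sgd f eta c x0 s k -
    (eta * clip_weight c (enorm (batch_grad f (s k) (clip_sgd f eta c x0 s k)))) *:
      batch_grad f (s k) (clip_sgd f eta c x0 s k).
Proof. by rewrite /= -scalerA clip_factorE// scalerA. Qed.

End Iteration.

Section MeasurableIterates.
Context {R : realType} {d : nat} {dT dS : measure_display}.
Context {T : measurableType dT} {S : measurableType dS}.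
Context (f : 'rV[R]_d -> T -> R) {B : nat} (eta c : R) (x0 : 'rV[R]_d).
Hypotheses (c_gt0 : 0 < c) (f_diff : forall z x, differentiable (f^~ z) x)
  (f_meas : forall x, measurable_fun [set: T] (f x)).

Lemma measurable_batch_grad (s : 'I_B -> S -> T) (y : S -> 'rV[R]_d) :
  (forall i, measurable_fun [set: S] (s i)) -> measurable_row y ->
  measurable_row (fun w => batch_grad f (fun i => s i w) (y w)).
Proof.
move=> ms my; apply: measurable_rowZ; first exact: measurable_cst.
apply: measurable_row_sum => i.
exact: (measurable_grad f_diff f_meas my (ms i)).
Qed.

Lemma measurable_clip_sgd (s : nat -> 'I_B -> S -> T) k :
  (forall k' i, (k' < k)%N -> measurable_fun [set: S] (s k' i)) ->
  measurable_row (fun w => clip_sgd f eta c x0 (fun k' i => s k' i w) k).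
Proof.
elim: k => [|k IH] ms; first exact: measurable_row_cst.
have mx : measurable_row (fun w => clip_sgd f eta c x0 (fun k' i => s k' i w) k).
  by apply: IH => k' i k'k; apply: ms; exact: ltnW.
have mg : measurable_row (fun w => batch_grad f (fun i => s k i w)
    (clip_sgd f eta c x0 (fun k' i => s k' i w) k)).
  by apply: measurable_batch_grad => // i; exact: ms.
under eq_fun do rewrite clip_sgdS//.
apply: measurable_rowD => //; apply: measurable_rowN; apply: measurable_rowZ => //.
apply: measurable_funM => //; apply: measurable_clip_weight => //.
exact: measurable_enorm.
Qed.

End MeasurableIterates.

(** * The order in which samples are drawn *)

Section SampleIndices.
Context {B : nat}.

(** The samples of the iterations before k and the first m samples of the batch
    of iteration k. *)
Definition drawn_before (k m : nat) : seq (nat * 'I_B) :=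
  [seq p : nat * 'I_B <- [seq (k', i) | k' <- iota 0 k.+1, i <- enum 'I_B] |
    (p.1 < k)%N || (p.1 == k) && (p.2 < m)%N].

Lemma drawn_before_uniq k m : uniq (drawn_before k m).
Proof.
apply: filter_uniq; apply: allpairs_uniq; rewrite ?iota_uniq ?enum_uniq//.
by move=> [a b] [a' b'].
Qed.

Lemma mem_drawn_before k m k' (i : 'I_B) :
  ((k', i) \in drawn_before k m) = ((k' < k) || (k' == k) && (i < m))%N.
Proof.
rewrite mem_filter; apply: andb_idr => h; apply/allpairsPdep; exists k', i.
rewrite mem_iota mem_enum add0n ltnS /=; split => //.
by case/orP: h => /= [/ltnW//|/andP[/eqP-> _]].
Qed.

End SampleIndices.

(** * Expected progress of clipped SGD *)

Section Analysis.
Context {R : realType} {d : nat} {dT : measure_display} {T : measurableType dT}.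
Context {D : probability T R} (f : 'rV[R]_d -> T -> R) (H0 H1 rho : R).
Context {dO : measure_display} {Omega : measurableType dO} {P : probability Omega R}.
Variables (xs : 'rV[R]_d) (B : nat) (xi : nat * 'I_B -> {RV P >-> T}).
Variables (x0 : 'rV[R]_d) (eta c : R).
Hypothesis f_int : forall x, D.-integrable [set: T] (fun z => (f x z)%:E).
Hypothesis f_diff : forall z x, differentiable (f^~ z) x.
Hypothesis F_diff : forall x, differentiable (objective D f) x.
Hypothesis F_min : forall x, objective D f xs <= objective D f x.
Hypotheses (H0_ge0 : 0 <= H0) (H1_ge0 : 0 <= H1).
Hypothesis f_ae : {ae D, forall z, H0H1_smooth H0 H1 (f^~ z) /\ grad_convex (f^~ z)}.
Hypothesis f_unbiased : unbiased_oracle D f.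
Hypothesis f_growth : strong_growth D f rho.
Hypothesis xi_iid : iid D xi.
Hypotheses (c_gt0 : 0 < c) (eta_gt0 : 0 < eta) (B_gt0 : (0 < B)%N).
Hypothesis B_large : 36 * (rho - 1) <= B%:R.

Local Notation F := (objective D f).
Local Notation G := (grad (objective D f)).
Local Notation R0 := (enorm (x0 - xs)).
Hypothesis eta_small :
  eta * (9 * (H0 + Num.max (Num.sqrt H1) (H1 * R0) * c)) <= 1.

Let x k w := clip_sgd f eta c x0 (fun k' i => xi (k', i) w) k.
Let g k w := batch_grad f (fun i => xi (k, i) w) (x k w).
Let gap k w := F (x k w) - F xs.
Let weight k w := clip_weight c (enorm (G (x k w))).
(* Its mean, times eta / 3, bounds the expected decrease of step k from below. *)
Let progress k w := weight k w * enorm (G (x k w)) ^+ 2.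

Let f_meas y : measurable_fun [set: T] (f y).
Proof. exact: measurable_value. Qed.

Let F_cont : continuous F.
Proof. by move=> y; exact: differentiable_continuous. Qed.

Section Composition.
Context {dS : measure_display} {S : measurableType dS} (y : S -> 'rV[R]_d).
Hypothesis y_meas : measurable_row y.

Lemma measurable_objective : measurable_fun [set: S] (fun s => F (y s)).
Proof.
exact: (@measurable_caratheodory _ _ _ _ S S (fun v _ => F v) (fun=> F_cont)
  (fun v => measurable_cst _) y id y_meas (@measurable_id _ _ _)).
Qed.

Lemma measurable_objective_grad : measurable_row (fun s => G (y s)).
Proof.
exact: (@measurable_grad _ _ _ _ S S (fun v _ => F v) (fun=> F_diff)
  (fun v => measurable_cst _) y id y_meas (@measurable_id _ _ _)).
Qed.

End Composition.

Lemma measurable_iterate k : measurable_row (x k).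
Proof.
apply: (measurable_clip_sgd eta x0 c_gt0 f_diff f_meas (s := fun k' i => xi (k', i))).
by move=> k' i _; exact: measurable_funP.
Qed.

Lemma measurable_iterate_past k m :
  measurable_row (x k : past xi (drawn_before k m) -> 'rV[R]_d).
Proof.
apply: (measurable_clip_sgd (S := past xi (drawn_before k m)) eta x0 c_gt0 f_diff
  f_meas (s := fun k' i => xi (k', i))) => k' i k'k.
by apply: measurable_past_var; rewrite mem_drawn_before k'k.
Qed.

(** The centred sum of the first m sample gradients of batch k. Truncating at m
    allows an induction over the samples of the batch. *)
Definition noise (k m : nat) (w : Omega) : 'rV[R]_d :=
  \sum_(i < B | (i < m)%N) (grad (f^~ (xi (k, i) w)) (x k w) - G (x k w)).

Lemma noise_total k w : g k w - G (x k w) = B%:R^-1 *: noise k B w.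
Proof.
rewrite /noise (eq_bigl xpredT) => [|i]; last by rewrite ltn_ord.
rewrite big_split /= sumrN sumr_const card_ord scalerDr scalerN.
rewrite -[G (x k w) *+ B]scaler_nat scalerA.
by rewrite mulVf ?scale1r// pnatr_eq0 -lt0n.
Qed.

Lemma noiseS k m (mB : (m < B)%N) w : noise k m.+1 w = noise k m w +
  (grad (f^~ (xi (k, Ordinal mB) w)) (x k w) - G (x k w)).
Proof.
rewrite /noise (bigD1 (Ordinal mB)) //= addrC; congr (_ + _); apply: eq_bigl => i.
by rewrite ltnS -val_eqE /= ltn_neqAle andbC.
Qed.

Lemma measurable_noise_past k m :
  measurable_row (noise k m : past xi (drawn_before k m) -> 'rV[R]_d).
Proof.
rewrite /noise; under eq_fun do rewrite big_mkcond.
apply: measurable_row_sum => i; case im: (i < m)%N; last exact: measurable_row_cst.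
have mx := @measurable_iterate_past k m.
apply: measurable_rowD; last exact/measurable_rowN/measurable_objective_grad.
apply: (measurable_grad f_diff f_meas mx).
by apply: measurable_past_var; rewrite mem_drawn_before eqxx im orbT.
Qed.

Lemma measurable_weight k : measurable_fun [set: Omega] (weight k).
Proof.
apply: measurable_clip_weight => //; apply: measurable_enorm.
exact/measurable_objective_grad/measurable_iterate.
Qed.

Lemma measurable_progress k : measurable_fun [set: Omega] (progress k).
Proof.
apply: measurable_funM; first exact: measurable_weight.
apply/measurable_funX/measurable_enorm.
exact/measurable_objective_grad/measurable_iterate.
Qed.

Lemma weight_ge0 k w : 0 <= weight k w.
Proof. exact/ltW/clip_weight_gt0. Qed.

Lemma progress_ge0 k w : 0 <= progress k w.
Proof. by rewrite mulr_ge0 ?weight_ge0 ?sqr_ge0. Qed.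

(** Conditionally on everything drawn before sample m, the new centred gradient
    adds at most (rho - 1) ||G||^2 to the second moment ([mean_sqr_shifted]). The
    cross term is integrated out inside the square, so that Tonelli is applied
    to nonnegative functions only. *)
Lemma weighted_noise_mean k q m : (m <= B)%N -> has_mean P (progress k) q ->
  exists2 v, v <= m%:R * (rho - 1) * q &
    has_mean P (fun w => weight k w * enorm (noise k m w) ^+ 2) v.
Proof.
move=> + qm; elim: m => [|m IH] mB.
  exists 0; first by rewrite !mul0r.
  under eq_fun do rewrite /noise big_pred0_eq enorm0 expr0n mulr0.
  exact: has_mean_cst.
have [v vle vm] := IH (ltnW mB).
pose J := drawn_before k m : seq (nat * 'I_B).
pose h (z : past xi J * T) := weight k z.1 * enorm (noise k m z.1 +
  (grad (f^~ z.2) (x k z.1) - G (x k z.1))) ^+ 2.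
have mx1 : measurable_row (fun z : past xi J * T => x k z.1).
  by move=> i; apply: (measurableT_comp (@measurable_iterate_past k m i)).
have mG1 := measurable_objective_grad mx1.
have mh : measurable_fun [set: past xi J * T] h.
  apply: measurable_funM.
    by apply: measurable_clip_weight => //; exact: measurable_enorm.
  apply/measurable_funX/measurable_enorm/measurable_rowD.
    by move=> i; apply: (measurableT_comp (@measurable_noise_past k m i)).
  apply: measurable_rowD; last exact: measurable_rowN.
  exact: (measurable_grad f_diff f_meas mx1 measurable_snd).
have h0 z : (0 <= (h z)%:E)%E.
  by rewrite lee_fin mulr_ge0 ?weight_ge0 ?sqr_ge0.
have i0J : (k, Ordinal mB) \notin J by rewrite mem_drawn_before ltnn eqxx ltnn.
have bound : (\int[P]_w (h (w, xi (k, Ordinal mB) w))%:E <= (v + (rho - 1) * q)%:E)%E.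
  have /measurable_EFinP mhE := mh.
  rewrite (integral_past xi_iid (drawn_before_uniq k m) i0J mhE h0).
  have [_ <-] := has_meanD vm (has_meanZ (rho - 1) qm).
  apply: ge0_le_integral => //.
  - by move=> w _; apply: integral_ge0 => z _; exact: h0.
  - apply: (measurableT_comp (measurable_fun_fubini_tonelli_F _ mhE h0)).
    exact: measurable_id_past.
  - apply/measurable_EFinP; apply: measurable_funD; first exact: has_mean_measurable vm.
    by apply: measurable_funM => //; exact: measurable_progress.
  move=> w _; rewrite /h /=; under eq_integral do rewrite EFinM.
  rewrite ge0_integralZl//; last 3 first.
  - apply/measurable_EFinP/measurable_funX/measurable_enorm/measurable_rowD.
      exact: measurable_row_cst.
    apply: measurable_rowD; last exact: measurable_row_cst.
    exact: measurable_sample_grad.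
  - by move=> z _; rewrite lee_fin sqr_ge0.
  - by rewrite lee_fin weight_ge0.
  apply: le_trans (_ : _ <= (weight k w * (enorm (noise k m w) ^+ 2 +
      (rho - 1) * enorm (G (x k w)) ^+ 2))%:E)%E _.
    rewrite [leRHS]EFinM lee_wpmul2l ?lee_fin ?weight_ge0//.
    exact: (mean_sqr_shifted f_int f_diff f_unbiased f_growth).
  by rewrite lee_fin /progress; lra.
have [||v' v'le v'm] := ge0_has_mean _ _ bound.
- apply: (measurableT_comp mh); apply: measurable_fun_pair.
    exact: measurable_id_past.
  exact: measurable_funP.
- by move=> w; have := h0 (w, xi (k, Ordinal mB) w); rewrite lee_fin.
exists v'; first by apply: le_trans v'le _; rewrite -natr1; lra.
by under eq_fun do rewrite noiseS.
Qed.

(** Averaging over the batch divides the second moment by B; the factor 1/36 is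
    what B >= 36 (rho - 1) leaves. *)
Lemma weighted_deviation_mean k q : has_mean P (progress k) q ->
  exists2 v, v <= q / 36 &
    has_mean P (fun w => weight k w * enorm (g k w - G (x k w)) ^+ 2) v.
Proof.
move=> qm; have [v vle vm] := weighted_noise_mean (leqnn B) qm.
have B0 : 0 < B%:R :> R by rewrite ltr0n.
have q0 : 0 <= q.
  by apply: has_mean_le (has_mean_cst 0) qm _; apply: aeW => w; exact: progress_ge0.
exists (B%:R^-1 ^+ 2 * v); last first.
  have := has_meanZ (B%:R^-1 ^+ 2) vm; congr (has_mean _ _ _).
  apply/funext => w; rewrite noise_total enormZ exprMn.
  by rewrite ger0_norm ?invr_ge0 ?ler0n// mulrCA.
rewrite exprVn mulrC ler_pdivrMr ?exprn_gt0//; apply: le_trans vle _.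
have : B%:R * (36 * (rho - 1)) <= B%:R * B%:R :> R by rewrite ler_pM2l.
move=> /(ler_wpM2r q0); rewrite expr2; lra.
Qed.

Lemma ae_good_batch k : {ae P, forall w, forall i : 'I_B,
  good_sample f H0 H1 xs (xi (k, i) w)}.
Proof.
apply: filter_forall => i.
have [N [mN N0 Ngood]] := ae_good_sample f_int f_diff F_diff F_min f_ae f_growth.
exists (xi (k, i) @^-1` N); split.
- exact: measurable_funPTI.
- by have [+ _] := xi_iid; move=> /(_ (k, i) N mN); rewrite N0.
- by move=> w /= bad; exact: Ngood.
Qed.

(** Each batch average is a convex smooth function minimised at xs, to which
    [clipped_step_contracts] applies. *)
Lemma ae_iterate_ball k : {ae P, forall w, enorm (x k w - xs) <= R0}.
Proof.
elim: k => [|k IH]; first exact: aeW.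
apply: filterS2 IH (ae_good_batch k) => w xR gw.
apply: le_trans (_ : _ <= enorm (x k w - xs)) (xR).
rewrite /x clip_sgdS// -/(x k w) -/(g k w).
apply: (clipped_step_contracts H0_ge0 H1_ge0 c_gt0 eta_gt0 (enorm_ge0 _) eta_small xR
  (batch_gap_ge0 gw _)); first exact: batch_gap_convex.
exact: batch_gap_descent (clipped_step_short H0_ge0 c_gt0 eta_gt0 eta_small _).
Qed.

Lemma gap_ge0 k w : 0 <= gap k w.
Proof. by rewrite subr_ge0. Qed.

Lemma gap_le_grad k w : enorm (x k w - xs) <= R0 -> gap k w <= enorm (G (x k w)) * R0.
Proof.
move=> xR; apply: le_trans (objective_convex f_int f_diff F_diff F_min f_ae f_unbiased f_growth _) _.
by apply: le_trans (cauchy_schwarz _ _) _; rewrite ler_wpM2l ?enorm_ge0.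
Qed.

Lemma gap_decrease y v : enorm (y - xs) <= R0 ->
  F (y - (eta * clip_weight c (enorm v)) *: v) - F xs
    + eta * clip_weight c (enorm (G y)) * (4 / 9) * enorm (G y) ^+ 2 <=
  F y - F xs + eta * clip_weight c (enorm (G y)) * (29 / 9) * enorm (v - G y) ^+ 2.
Proof.
move=> yR; apply: (clipped_step_decreases H0_ge0 H1_ge0 c_gt0 eta_gt0 (enorm_ge0 _)
  eta_small yR).
- by rewrite subr_ge0.
- exact: (objective_convex f_int f_diff F_diff F_min f_ae f_unbiased f_growth).
have := objective_descent f_int f_diff F_diff F_min f_ae f_unbiased f_growth
  (x := y) (y := y - (eta * clip_weight c (enorm v)) *: v).
rewrite addrAC subrr add0r enormN dotpNr.
by move=> /(_ (clipped_step_short H0_ge0 c_gt0 eta_gt0 eta_small v)); lra.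
Qed.

Lemma measurable_gap k : measurable_fun [set: Omega] (gap k).
Proof.
apply: measurable_funB; last exact: measurable_cst.
exact/measurable_objective/measurable_iterate.
Qed.

(** A clipped step along the exact gradient decreases the objective, which stays
    above its minimum; so the gain is dominated by the gap. This finiteness is
    needed to subtract expectations of gains. *)
Lemma progress_mean k u : has_mean P (gap k) u -> exists q, has_mean P (progress k) q.
Proof.
move=> um; have := has_meanZ (9 / (4 * eta)) um.
apply: ge0_has_mean_dominated; first exact: measurable_progress.
- by move=> w; exact: progress_ge0.
- by move=> w; rewrite mulr_ge0 ?gap_ge0// divr_ge0// mulr_ge0// ltW.
apply: filterS (ae_iterate_ball k) => w xR.
have := gap_decrease (G (x k w)) xR.
have := F_min (x k w - (eta * clip_weight c (enorm (G (x k w)))) *: G (x k w)).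
rewrite subrr enorm0 expr0n /= mulr0 addr0 => Fpos dec.
rewrite mulrAC ler_pdivlMr ?mulr_gt0//.
by rewrite /progress /gap /weight; lra.
Qed.

(** The constants combine as 4/9 - 29/9 / 36 = 115/324 >= 1/3. *)
Lemma expected_decrease k u q : has_mean P (gap k) u -> has_mean P (progress k) q ->
  exists2 u', u' + eta / 3 * q <= u & has_mean P (gap k.+1) u'.
Proof.
move=> um qm; have [v vle vm] := weighted_deviation_mean qm.
have dec : {ae P, forall w, gap k.+1 w + eta * (4 / 9) * progress k w <=
    gap k w + eta * (29 / 9) * (weight k w * enorm (g k w - G (x k w)) ^+ 2)}.
  apply: filterS (ae_iterate_ball k) => w xR.
  have := gap_decrease (g k w) xR.
  by rewrite /gap /x clip_sgdS// -/(x k w) -/(g k w) /progress /weight; lra.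
have rhs := has_meanD um (has_meanZ (eta * (29 / 9)) vm).
have [|w|w||u' u'm] := ge0_has_mean_dominated _ _ _ _ rhs (u := gap k.+1).
- exact: measurable_gap.
- exact: gap_ge0.
- apply: addr_ge0; first exact: gap_ge0.
  apply: mulr_ge0; first by rewrite mulr_ge0// ltW.
  by apply: mulr_ge0; [exact: weight_ge0|exact: sqr_ge0].
- apply: filterS dec => w; apply: le_trans; rewrite lerDl.
  by rewrite mulr_ge0 ?progress_ge0// mulr_ge0// ltW.
exists u' => //.
have := has_mean_le (has_meanD u'm (has_meanZ (eta * (4 / 9)) qm)) rhs dec.
have : eta * v <= eta * (q / 36) by rewrite ler_pM2l.
have : 0 <= eta * q.
  apply: mulr_ge0; first exact: ltW.
  by apply: has_mean_le (has_mean_cst 0) qm _; apply: aeW => w; exact: progress_ge0.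
lra.
Qed.

Definition mean_gap k := fine (\int[P]_w (gap k w)%:E)%E.

Lemma has_mean_gap k : has_mean P (gap k) (mean_gap k).
Proof.
suff [u um] : exists u, has_mean P (gap k) u by rewrite /mean_gap (proj2 um).
elim: k => [|k [u um]]; first by exists (F x0 - F xs); exact: (has_mean_cst (F x0 - F xs)).
have [q qm] := progress_mean um.
by have [u' _ u'm] := expected_decrease um qm; exists u'.
Qed.

Lemma mean_gap_ge0 k : 0 <= mean_gap k.
Proof.
apply: has_mean_le (has_mean_cst 0) (has_mean_gap k) _.
by apply: aeW => w; exact: gap_ge0.
Qed.

Lemma mean_gap0 : mean_gap 0 = F x0 - F xs.
Proof.
have [_] := @has_mean_cst _ _ _ P (F x0 - F xs).
by rewrite /mean_gap /gap /x /= => ->.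
Qed.

(** Expectation of the tangent inequality at s, for every s up to the threshold
    c R0 / 2. A tangent is affine in the gap, so its expectation is its value at
    the mean gap. *)
Lemma mean_gap_step k s : 0 < R0 -> 0 <= s -> s <= c * R0 / 2 ->
  mean_gap k.+1 + 2 * (eta / (3 * R0 ^+ 2)) * s * mean_gap k <=
  mean_gap k + eta / (3 * R0 ^+ 2) * s ^+ 2.
Proof.
move=> R0_gt0 s0 sc; have um := has_mean_gap k.
have [q qm] := progress_mean um.
have [u' u'le [_ u'm]] := expected_decrease um qm.
have -> : mean_gap k.+1 = u' by rewrite /mean_gap u'm.
have tangent : 2 * (eta / (3 * R0 ^+ 2)) * s * mean_gap k
    <= eta / 3 * q + eta / (3 * R0 ^+ 2) * s ^+ 2.
  apply: has_mean_le (has_meanZ _ um)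
    (has_meanD (has_meanZ (eta / 3) qm) (has_mean_cst (eta / (3 * R0 ^+ 2) * s ^+ 2))) _.
  apply: filterS (ae_iterate_ball k) => w xR.
  apply: le_trans (huber_tangent eta_gt0 c_gt0 R0_gt0 (gap_ge0 k w) s0 sc) _.
  rewrite lerD2r ler_pM2l ?divr_gt0//.
  apply: clip_weightM_sq => //; [exact: enorm_ge0|exact: gap_ge0|exact: gap_le_grad].
lra.
Qed.

(** Started at the minimiser, the iterates never leave it. *)
Lemma mean_gap_at_minimizer k : R0 = 0 -> mean_gap k = 0.
Proof.
move=> R00; apply/eqP; rewrite eq_le mean_gap_ge0 andbT.
apply: has_mean_le (has_mean_gap k) (has_mean_cst 0) _.
by apply: filterS (ae_iterate_ball k) => w /gap_le_grad; rewrite R00 mulr0.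
Qed.

(** Apply [two_phase_rate] with b = eta / (3 R0^2) and sigma = c R0 / 2. The case
    R0 = 0 is separate because b has R0 in its denominator. *)
Lemma mean_gap_rate N : mean_gap N <= Num.max
  (Num.max 0 (1 - eta * c / (36 * R0)) `^ (N%:R / 2) * (F x0 - F xs))
  (18 * R0 ^+ 2 / (N%:R * eta)).
Proof.
have n0 : 0 <= N%:R :> R by rewrite ler0n.
have tail0 : 0 <= R0 ^+ 2 / (N%:R * eta) by rewrite divr_ge0 ?sqr_ge0 ?mulr_ge0// ltW.
have [R00|R0n] := eqVneq R0 0.
  rewrite mean_gap_at_minimizer// le_max; apply/orP; right.
  by rewrite -mulrA mulr_ge0.
have R0_gt0 : 0 < R0 by rewrite lt_def R0n enorm_ge0.
pose b := eta / (3 * R0 ^+ 2).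
have b_gt0 : 0 < b by rewrite divr_gt0// mulr_gt0// exprn_gt0.
have a_gt0 : 0 < eta * c / R0 by rewrite divr_gt0// mulr_gt0.
have qE : eta * c / (36 * R0) = eta * c / R0 / 36 by field.
have bsE : b * (c * R0 / 2) = eta * c / R0 / 6 by rewrite /b; field.
have step k s : 0 <= s -> s <= c * R0 / 2 ->
    mean_gap k.+1 + 2 * b * s * mean_gap k <= mean_gap k + b * s ^+ 2.
  exact: mean_gap_step.
have := two_phase_rate (Q := Num.max 0 (1 - eta * c / (36 * R0)))
  mean_gap_ge0 b_gt0 _ _ _ _ step N.
rewrite mean_gap0 => /(_ _ _ _ _)/le_trans; apply.
- by rewrite divr_ge0// mulr_ge0// ltW.
- by rewrite le_max lexx.
- by rewrite ge_max ler01 qE; lra.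
- by rewrite le_max qE bsE; apply/orP; right; lra.
have -> : 2 / (b * N%:R) = 6 * (R0 ^+ 2 / (N%:R * eta)).
  rewrite /b; have [->|N0] := eqVneq (N%:R : R) 0.
    by rewrite !(mulr0, mul0r, invr0).
  by field; rewrite N0 R0n gt_eqF.
rewrite ge_max !le_max lexx /=; apply/orP; right; rewrite -mulrA; lra.
Qed.

End Analysis.

(** * Convergence of clipped SGD *)

Theorem theoremC8 (R : realType) (d : nat)
    (dT : measure_display) (T : measurableType dT) (D : probability T R)
    (f : 'rV[R]_d -> T -> R) (H0 H1 rho : R) (xstar : 'rV[R]_d)
    (dO : measure_display) (Omega : measurableType dO) (P : probability Omega R)
    (B : nat) (xi : nat * 'I_B -> {RV P >-> T})
    (x0 : 'rV[R]_d) (eta c : R) (N : nat) :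
  (forall x, D.-integrable [set: T] (fun z => (f x z)%:E)) ->
  (forall z x, differentiable (f^~ z) x) ->
  (forall x, differentiable (objective D f) x) ->
  (forall x, objective D f xstar <= objective D f x) ->
  0 <= H0 -> 0 <= H1 ->
  {ae D, forall z, H0H1_smooth H0 H1 (f^~ z) /\ grad_convex (f^~ z)} ->
  unbiased_oracle D f ->
  1 <= rho ->
  strong_growth D f rho ->
  iid D xi ->
  let R0 := enorm (x0 - xstar) in
  let F0 := objective D f x0 - objective D f xstar in
  let x k w := clip_sgd f eta c x0 (fun k' i => xi (k', i) w) k in
  0 < c ->
  0 < eta ->
  eta * (9 * (H0 + Num.max (Num.sqrt H1) (H1 * R0) * c)) <= 1 ->
  (1 <= B)%N ->
  36 * (rho - 1) <= B%:R ->
  ('E_P[fun w => objective D f (x N w)] - (objective D f xstar)%:E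
    <= (Num.max
          (Num.max 0 (1 - eta * c / (36 * R0)) `^ (N%:R / 2) * F0)
          (18 * R0 ^+ 2 / (N%:R * eta)))%:E)%E.

Proof.
move=> f_int f_diff F_diff F_min H0_ge0 H1_ge0 f_ae f_unbiased rho_ge1 f_growth xi_iid.
move=> R0 F0 x c_gt0 eta_gt0 eta_small B_gt0 B_large.
have gapm := has_mean_gap f_int f_diff F_diff F_min H0_ge0 H1_ge0 f_ae f_unbiased
  f_growth xi_iid c_gt0 eta_gt0 B_gt0 B_large eta_small N.
have [_ Fm] := has_meanD gapm (has_mean_cst (objective D f xstar)).
have -> : ('E_P[fun w => objective D f (x N w)] = \int[P]_w
    (objective D f (x N w) - objective D f xstar + objective D f xstar)%:E)%E.
  by rewrite unlock; apply: eq_integral => w _; rewrite subrK.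
rewrite Fm -EFinB addrK lee_fin.
exact: (mean_gap_rate f_int f_diff F_diff F_min H0_ge0 H1_ge0 f_ae f_unbiased
  f_growth xi_iid c_gt0 eta_gt0 B_gt0 B_large eta_small).
Qed.
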